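(* The following hold in $\mathbf{ZF}$: (a) $\mathbf{CUC}$ is equivalent to the statement ''For every infinite set $X$, $[X]^{\leq\omega}$ is a $\sigma$-ideal''. (b) $\mathbf{PS}_0\rightarrow\mathbf{PS}_1\rightarrow\mathbf{CUC}$. (c) $\mathbf{IDI}\rightarrow\mathbf{PS}_2$.
   Context: The background theory is $\mathbf{ZF}$ (no axiom of choice). A set is countable if it injects into $\omega$, and uncountable otherwise. $[X]^{<\omega}$, $[X]^{\leq\omega}$ are the sets of finite, respectively countable, subsets of $X$. A $\sigma$-ideal is an ideal of sets closed under unions of sequences indexed by $\omega$. For an infinite set $X$, $\mathbf{S}(X,[X]^{\leq\omega})$ is the set $[X]^{<\omega}$ with the topology consisting of all $V\subseteq[X]^{<\omega}$ such that for every $x\in V$ there is $z\in[X]^{\leq\omega}$ with $x\cap z=\emptyset$ and $\{y\in[X]^{<\omega}:x\subseteq y\subseteq X\setminus z\}\subseteq V$. A $P$-space is a topological space in which every $G_\delta$-set (countable intersection of open sets) is open. $\mathbf{CUC}$: countable unions of countable sets are countable. $\mathbf{IDI}$: every infinite set is Dedekind-infinite (i.e. $\omega$ injects into it). $\mathbf{PS}_0$: for every uncountable set $X$, $\mathbf{S}(X,[X]^{\leq\omega})$ is a $P$-space. $\mathbf{PS}_1$: for every uncountable set $X$ there is an uncountable $Y\subseteq X$ such that $\mathbf{S}(Y,[Y]^{\leq\omega})$ is a $P$-space. $\mathbf{PS}_2$: for every infinite set $X$ there is an infinite $Y\subseteq X$ such that $\mathbf{S}(Y,[Y]^{\leq\omega})$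 is a $P$-space. *)

(* Defs.v *)
(** "Holds in ZF" is read as "holds in every model of
    first-order ZF".  All notions below are first-order properties of the
    elements of such a model: sets, functions, sequences and countable families
    are elements of the model, and choice principles available in the ambient
    logic say nothing about them. *)

Set Implicit Arguments.

Record set_structure : Type := SetStructure {
  carrier :> Type;
  mem : carrier -> carrier -> Prop
}.
Arguments mem {s} x y.

Notation "x ∈ y" := (mem x y) (at level 70, no associativity).

(** ** First-order formulas in the language of set theory

    Variables are de Bruijn indices.  The deep embedding is needed so that
    Separation and Replacement range over first-order formulas with parameters;
    if they ranged over all predicates [M -> Prop], then choice in the ambient
    logic would force choice in [M]. *)

Inductive formula : Type :=
| FMem (i j : nat)
| FEq (i j : nat)
| FFalse
| FImp (p q : formula)
| FAnd (p q : formula)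
| FOr (p q : formula)
| FAll (p : formula)
| FEx (p : formula).

Definition scons (A : Type) (x : A) (rho : nat -> A) (n : nat) : A :=
  match n with
  | O => x
  | S m => rho m
  end.

Fixpoint sat (M : set_structure) (rho : nat -> M) (p : formula) : Prop :=
  match p with
  | FMem i j => rho i ∈ rho j
  | FEq i j => rho i = rho j
  | FFalse => False
  | FImp p q => sat M rho p -> sat M rho q
  | FAnd p q => sat M rho p /\ sat M rho q
  | FOr p q => sat M rho p \/ sat M rho q
  | FAll p => forall x : M, sat M (scons x rho) p
  | FEx p => exists x : M, sat M (scons x rho) p
  end.

(** ** Basic set-theoretic vocabulary *)

Section Vocabulary.
Variable M : set_structure.
Implicit Types a b f p u v w x y z A B : M.

Definition subset x y : Prop := forall t : M, t ∈ x -> t ∈ y.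
Definition disjoint x y : Prop := forall t : M, ~ (t ∈ x /\ t ∈ y).
Definition is_empty x : Prop := forall t : M, ~ t ∈ x.
Definition is_succ x y : Prop := forall t : M, t ∈ y <-> t ∈ x \/ t = x.
Definition is_upair a b p : Prop := forall t : M, t ∈ p <-> t = a \/ t = b.
Definition is_union a u : Prop :=
  forall t : M, t ∈ u <-> exists x, x ∈ a /\ t ∈ x.
Definition is_union2 a b u : Prop := forall t : M, t ∈ u <-> t ∈ a \/ t ∈ b.

(** Kuratowski pairs. *)
Definition is_pair a b p : Prop :=
  exists u v, is_upair a a u /\ is_upair a b v /\ is_upair u v p.

Definition maps_to f x y : Prop := exists p, is_pair x y p /\ p ∈ f.

Definition is_function f A B : Prop :=
  (forall p, p ∈ f -> exists x y, x ∈ A /\ y ∈ B /\ is_pair x y p) /\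
  (forall x, x ∈ A -> exists! y, maps_to f x y).

Definition is_injection f A B : Prop :=
  is_function f A B /\
  forall x x' y, maps_to f x y -> maps_to f x' y -> x = x'.

Definition is_bijection f A B : Prop :=
  is_injection f A B /\ forall y, y ∈ B -> exists x, maps_to f x y.

Definition inductive_set w : Prop :=
  (exists e, is_empty e /\ e ∈ w) /\
  (forall x, x ∈ w -> exists s, is_succ x s /\ s ∈ w).

Definition is_omega w : Prop :=
  inductive_set w /\ forall w', inductive_set w' -> subset w w'.

Definition finite x : Prop :=
  exists w n f, is_omega w /\ n ∈ w /\ is_bijection f x n.
Definition infinite x : Prop := ~ finite x.

Definition countable x : Prop :=
  exists w f, is_omega w /\ is_injection f x w.
Definition uncountable x : Prop := ~ countable x.

Definition dedekind_infinite x : Prop :=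
  exists w f, is_omega w /\ is_injection f w x.

(** [[X]^{<ω}] and [[X]^{≤ω}], given by their elements. *)
Definition finite_subsets (X y : M) : Prop := subset y X /\ finite y.
Definition countable_subsets (X y : M) : Prop := subset y X /\ countable y.

(** Ideals may be improper: [[X]^{≤ω}] is the whole power set of [X] when [X]
    is countable. *)
Definition is_ideal (I : M -> Prop) : Prop :=
  (forall e, is_empty e -> I e) /\
  (forall a b, I b -> subset a b -> I a) /\
  (forall a b u, I a -> I b -> is_union2 a b u -> I u).

(** [f] is a sequence indexed by ω with values in [I]; [u] is the union of its
    terms. *)
Definition is_sigma_ideal (I : M -> Prop) : Prop :=
  is_ideal I /\
  forall w f B u, is_omega w -> is_function f w B -> (forall y, y ∈ B -> I y) ->
    (forall t, t ∈ u <-> exists n y, maps_to f n y /\ t ∈ y) -> I u.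

(** A space is given by its points and its open sets. *)
Definition is_Gdelta (points opens : M -> Prop) (g : M) : Prop :=
  exists F : M, countable F /\ (forall U, U ∈ F -> opens U) /\
    forall x, x ∈ g <-> points x /\ forall U, U ∈ F -> x ∈ U.

Definition is_P_space (points opens : M -> Prop) : Prop :=
  forall g : M, is_Gdelta points opens g -> opens g.

(** The open sets of [S(X, I)], whose set of points is [finite_subsets X]. *)
Definition S_open (X : M) (I : M -> Prop) (V : M) : Prop :=
  (forall x, x ∈ V -> finite_subsets X x) /\
  forall x, x ∈ V ->
    exists z, I z /\ disjoint x z /\
      forall y, finite_subsets X y -> subset x y -> disjoint y z -> y ∈ V.

Definition S_countable_is_P_space (X : M) : Prop :=
  is_P_space (finite_subsets X) (S_open X (countable_subsets X)).

End Vocabulary.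

(** ** The axioms of ZF *)

Record models_ZF (M : set_structure) : Prop := ModelsZF {
  extensionality : forall x y : M, (forall t : M, t ∈ x <-> t ∈ y) -> x = y;
  foundation : forall x : M, (exists t : M, t ∈ x) ->
    exists y : M, y ∈ x /\ disjoint M y x;
  pairing : forall a b : M, exists p : M, is_upair M a b p;
  union : forall a : M, exists u : M, is_union M a u;
  power_set : forall a : M, exists p : M, forall x : M, x ∈ p <-> subset M x a;
  infinity : exists w : M, inductive_set M w;
  separation : forall (phi : formula) (rho : nat -> M) (a : M),
    exists b : M, forall x : M, x ∈ b <-> x ∈ a /\ sat M (scons x rho) phi;
  replacement : forall (phi : formula) (rho : nat -> M) (a : M),
    (forall x : M, x ∈ a -> exists! y : M, sat M (scons x (scons y rho)) phi) ->
    exists b : M, forall y : M,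
      y ∈ b <-> exists x : M, x ∈ a /\ sat M (scons x (scons y rho)) phi
}.

(** ** The principles *)

Section Principles.
Variable M : set_structure.

Definition CUC : Prop :=
  forall A u : M, countable M A -> (forall x : M, x ∈ A -> countable M x) ->
    is_union M A u -> countable M u.

Definition IDI : Prop :=
  forall X : M, infinite M X -> dedekind_infinite M X.

Definition PS0 : Prop :=
  forall X : M, uncountable M X -> S_countable_is_P_space M X.

Definition PS1 : Prop :=
  forall X : M, uncountable M X ->
    exists Y : M, subset M Y X /\ uncountable M Y /\ S_countable_is_P_space M Y.

Definition PS2 : Prop :=
  forall X : M, infinite M X ->
    exists Y : M, subset M Y X /\ infinite M Y /\ S_countable_is_P_space M Y.

End Principles.

(* Main.v *)
(** In (b), suppose [u] is an uncountable union of a countable family [A] of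
    countable sets, and let [Y ⊆ u] be as in [PS1].  For [a ∈ A] the set of all
    finite subsets of [Y] that miss [a] is open, and these sets intersect in
    [{∅}]; so [{∅}] is open, which means that some countable [z ⊆ Y] meets
    every nonempty finite subset of [Y], i.e. [Y = z].  In (c), if [Y] is the
    range of an injection of ω then [S(Y, [Y]^{≤ω})] is discrete. *)

From Stdlib Require Import Classical.
Require Import Defs.

Local Notation "x .: r" := (scons x r) (at level 60, right associativity).

(** ** Definability *)

Section Definability.
Variable M : set_structure.

(** A semantic notion, so that formulas for Separation are assembled by the closure lemmas below
    instead of being written with de Bruijn indices. *)
Definition definable (P : (nat -> M) -> Prop) : Prop :=
  exists phi, forall r, P r <-> sat M r phi.

Lemma definable_mem i j : definable (fun r => r i ∈ r j).
Proof. exists (FMem i j). reflexivity. Qed.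

Lemma definable_eq i j : definable (fun r => r i = r j).
Proof. exists (FEq i j). reflexivity. Qed.

Lemma definable_false : definable (fun _ => False).
Proof. exists FFalse. reflexivity. Qed.

Lemma definable_imp P Q :
  definable P -> definable Q -> definable (fun r => P r -> Q r).
Proof.
  intros [p Hp] [q Hq]. exists (FImp p q). intro r. simpl.
  rewrite Hp, Hq. reflexivity.
Qed.

Lemma definable_and P Q :
  definable P -> definable Q -> definable (fun r => P r /\ Q r).
Proof.
  intros [p Hp] [q Hq]. exists (FAnd p q). intro r. simpl.
  rewrite Hp, Hq. reflexivity.
Qed.

Lemma definable_or P Q :
  definable P -> definable Q -> definable (fun r => P r \/ Q r).
Proof.
  intros [p Hp] [q Hq]. exists (FOr p q). intro r. simpl.
  rewrite Hp, Hq. reflexivity.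
Qed.

(** The bound variable takes index 0 and all other variables move up by one. Applied to [x .: r],
    the two arguments of [Q] reduce to [x] and [r]. *)
Lemma definable_all (Q : M -> (nat -> M) -> Prop) :
  definable (fun r => Q (r 0) (fun n => r (S n))) ->
  definable (fun r => forall x, Q x r).
Proof.
  intros [q Hq]. exists (FAll q). intro r. simpl.
  split; intros H x; [apply Hq | apply (Hq (x .: r))]; apply H.
Qed.

Lemma definable_ex (Q : M -> (nat -> M) -> Prop) :
  definable (fun r => Q (r 0) (fun n => r (S n))) ->
  definable (fun r => exists x, Q x r).
Proof.
  intros [q Hq]. exists (FEx q). intro r. simpl.
  split; intros [x H]; exists x; [apply Hq | apply (Hq (x .: r))]; apply H.
Qed.

(** The parameters [fun n => r (k + n)] are read off at an arbitrary offset [k],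
    so that such predicates can be used under further quantifiers. *)
Definition definable1 (P : M -> (nat -> M) -> Prop) : Prop :=
  forall i k, definable (fun r => P (r i) (fun n => r (k + n))).

Definition definable2 (R : M -> M -> (nat -> M) -> Prop) : Prop :=
  forall i j k, definable (fun r => R (r i) (r j) (fun n => r (k + n))).

End Definability.

Ltac unfold_vocabulary :=
  unfold finite_subsets, countable_subsets, countable, finite, is_bijection,
    is_injection, is_function, maps_to, is_pair, is_upair, is_omega,
    inductive_set, is_succ, is_empty, subset, disjoint, unique, iff, not.

(** Once the vocabulary is reduced to membership, equality and connectives, the head symbol of the
    goal determines which closure lemma applies. *)
Ltac prove_definable :=
  unfold definable1, definable2; intros;
  unfold_vocabulary;
  repeat first
    [ apply definable_mem | apply definable_eq | apply definable_false
    | apply definable_and | apply definable_or | apply definable_imp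
    | apply definable_all; cbv beta | apply definable_ex; cbv beta ].

Section ZF.
Variable M : set_structure.
Hypothesis hM : models_ZF M.
Implicit Types a b f p x y z A B w : M.

Lemma separation_definable (P : M -> (nat -> M) -> Prop) (r : nat -> M) a :
  definable1 M P -> exists b, forall x, x ∈ b <-> x ∈ a /\ P x r.
Proof.
  (* In [x .: r] the tested element has index 0 and the parameters start at index 1. *)
  intros HP. destruct (HP 0 1) as [phi H].
  destruct (separation hM phi r a) as [b Hb].
  exists b. intro x. rewrite Hb, <- H. reflexivity.
Qed.

(** ** Elementary sets and relations *)

(** Foundation applied to the singleton of [x]. *)
Lemma mem_irrefl x : ~ x ∈ x.
Proof.
  intro Hx. destruct (pairing hM x x) as [s Hs].
  destruct (foundation hM s) as [y [Hy Hd]].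
  - exists x. apply Hs. auto.
  - assert (y = x) as -> by (apply Hs in Hy; tauto).
    apply (Hd x). split; [exact Hx | exact Hy].
Qed.

Lemma empty_exists : exists e : M, is_empty M e.
Proof.
  destruct (infinity hM) as [w [[e [He _]] _]]. exists e. exact He.
Qed.

Lemma empty_unique x y : is_empty M x -> is_empty M y -> x = y.
Proof.
  intros Hx Hy. apply (extensionality hM). intro t.
  specialize (Hx t). specialize (Hy t). tauto.
Qed.

Lemma union2_exists a b : exists u, is_union2 M a b u.
Proof.
  destruct (pairing hM a b) as [p Hp]. destruct (union hM p) as [u Hu].
  exists u. intro t. rewrite (Hu t). split.
  - intros [x [Hx Ht]]. apply Hp in Hx as [-> | ->]; auto.
  - intros [H | H]; [exists a | exists b]; rewrite (Hp _); auto.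
Qed.

Lemma succ_exists x : exists y, is_succ M x y.
Proof.
  destruct (pairing hM x x) as [s Hs]. destruct (union2_exists x s) as [y Hy].
  exists y. intro t. rewrite (Hy t), (Hs t). tauto.
Qed.

Lemma succ_unique x y z : is_succ M x y -> is_succ M x z -> y = z.
Proof.
  intros Hy Hz. apply (extensionality hM). intro t.
  rewrite (Hy t), (Hz t). reflexivity.
Qed.

Lemma pair_exists a b : exists p, is_pair M a b p.
Proof.
  destruct (pairing hM a a) as [u Hu]. destruct (pairing hM a b) as [v Hv].
  destruct (pairing hM u v) as [p Hp]. exists p, u, v. auto.
Qed.

Lemma upair_inj a b c d p :
  is_upair M a b p -> is_upair M c d p -> (a = c /\ b = d) \/ (a = d /\ b = c).
Proof.
  intros H K.
  assert (a = c \/ a = d) by (apply K, H; auto).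
  assert (b = c \/ b = d) by (apply K, H; auto).
  assert (c = a \/ c = b) by (apply H, K; auto).
  assert (d = a \/ d = b) by (apply H, K; auto).
  intuition congruence.
Qed.

Lemma pair_inj a b c d p :
  is_pair M a b p -> is_pair M c d p -> a = c /\ b = d.
Proof.
  intros (u & v & Hu & Hv & Hp) (u' & v' & Hu' & Hv' & Hq).
  destruct (upair_inj _ _ _ _ _ Hp Hq) as [[-> ->] | [-> ->]].
  - destruct (upair_inj _ _ _ _ _ Hu Hu') as [[-> _] | [-> _]];
      destruct (upair_inj _ _ _ _ _ Hv Hv') as [[E1 E2] | [E1 E2]];
      split; congruence.
  - destruct (upair_inj _ _ _ _ _ Hu Hv') as [[E1 E2] | [E1 E2]];
      destruct (upair_inj _ _ _ _ _ Hv Hu') as [[E3 E4] | [E3 E4]];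
      split; congruence.
Qed.

(** Kuratowski pairs over [A] and [B] lie in the double power set of the union of [A] and [B], from
    which Separation cuts out the product. *)
Lemma product_exists A B :
  exists C, forall p, p ∈ C <-> exists x y, x ∈ A /\ y ∈ B /\ is_pair M x y p.
Proof.
  destruct (union2_exists A B) as [C HC].
  destruct (power_set hM C) as [PC HPC].
  destruct (power_set hM PC) as [PPC HPPC].
  destruct (separation_definable
    (fun p r => exists x y, x ∈ r 0 /\ y ∈ r 1 /\ is_pair M x y p)
    (A .: fun _ => B) PPC ltac:(prove_definable)) as [D HD].
  cbn [scons] in HD.
  exists D. intro p. rewrite HD. split; [tauto|]. intro H. split; [|exact H].
  destruct H as (x & y & Hx & Hy & u & v & Hu & Hv & Hp).
  apply HPPC. intros c Hc. apply HPC. intros t Ht. apply HC.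
  apply Hp in Hc as [-> | ->]; [apply Hu in Ht | apply Hv in Ht];
    destruct Ht as [-> | ->]; auto.
Qed.

(** This turns a definable relation into an element of the model, which can then serve as a single
    parameter in further definitions. *)
Lemma relation_exists (R : M -> M -> (nat -> M) -> Prop) (r : nat -> M) A B :
  definable2 M R ->
  exists f,
    (forall p, p ∈ f -> exists x y, x ∈ A /\ y ∈ B /\ is_pair M x y p) /\
    (forall x y, maps_to M f x y <-> x ∈ A /\ y ∈ B /\ R x y r).
Proof.
  intro HR. destruct (product_exists A B) as [C HC].
  destruct (separation_definable
    (fun p r => exists y x, is_pair M x y p /\ R x y r) r C) as [f Hf].
  { intros i k.
    (* Since [x] is bound inside [y], they get indices 0 and 1, and the parameters start two places
       later. *)
    apply definable_ex, definable_ex, definable_and; [prove_definable|].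
    apply (HR 0 1 (S (S k))). }
  exists f. split.
  - intros p Hp. apply HC. apply Hf in Hp. tauto.
  - intros x y. split.
    + intros (p & Hp & Hpf). apply Hf in Hpf as [HpC (y' & x' & Hp' & HRp)].
      destruct (pair_inj _ _ _ _ _ Hp Hp') as [<- <-].
      apply HC in HpC as (x' & y' & Hx & Hy & Hp'').
      destruct (pair_inj _ _ _ _ _ Hp Hp'') as [<- <-]. auto.
    + intros (Hx & Hy & HRxy). destruct (pair_exists x y) as [p Hp].
      exists p. split; [exact Hp|]. apply Hf. split.
      * apply HC. exists x, y. auto.
      * exists y, x. auto.
Qed.

Lemma function_exists (R : M -> M -> (nat -> M) -> Prop) (r : nat -> M) A B :
  definable2 M R ->
  (forall x, x ∈ A -> exists! y, y ∈ B /\ R x y r) ->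
  exists f, is_function M f A B /\
    forall x y, maps_to M f x y <-> x ∈ A /\ y ∈ B /\ R x y r.
Proof.
  intros HR Hfun. destruct (relation_exists R r A B HR) as [f [Hf Hmap]].
  exists f. split; [|exact Hmap]. split; [exact Hf|].
  intros x Hx. destruct (Hfun x Hx) as [y [Hy Huniq]].
  exists y. split; [apply Hmap; tauto|].
  intros y' Hy'. apply Huniq. apply Hmap in Hy'. tauto.
Qed.

Lemma function_total f A B x :
  is_function M f A B -> x ∈ A -> exists y, y ∈ B /\ maps_to M f x y.
Proof.
  intros [Hf Hfun] Hx. destruct (Hfun x Hx) as [y [(p & Hp & Hpf) _]].
  exists y. split; [|exists p; auto].
  destruct (Hf p Hpf) as (x' & y' & _ & Hy' & Hp').
  destruct (pair_inj _ _ _ _ _ Hp Hp') as [_ ->]. exact Hy'.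
Qed.

Lemma function_domain f A B x y :
  is_function M f A B -> maps_to M f x y -> x ∈ A.
Proof.
  intros [Hf _] (p & Hp & Hpf).
  destruct (Hf p Hpf) as (x' & y' & Hx & _ & Hp').
  destruct (pair_inj _ _ _ _ _ Hp Hp') as [-> _]. exact Hx.
Qed.

Lemma function_unique f A B x y y' :
  is_function M f A B -> maps_to M f x y -> maps_to M f x y' -> y = y'.
Proof.
  intros Hf Hy Hy'. pose proof (function_domain _ _ _ _ _ Hf Hy) as Hx.
  destruct Hf as [_ Hfun]. destruct (Hfun x Hx) as [z [_ Hz]].
  rewrite <- (Hz y Hy). exact (Hz y' Hy').
Qed.

(** ** The natural numbers *)

Lemma omega_exists : exists w, is_omega M w.
Proof.
  destruct (infinity hM) as [v Hv].
  (* The intersection of all inductive sets, cut out of one of them. The quantifier over [v'] ranges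
     over elements of the model, so the condition is first-order. *)
  destruct (separation_definable
    (fun x _ => forall v', inductive_set M v' -> x ∈ v')
    (fun _ => v) v ltac:(prove_definable)) as [w Hw].
  exists w. split.
  - split.
    + destruct empty_exists as [e He]. exists e. split; [exact He|].
      assert (H : forall v', inductive_set M v' -> e ∈ v').
      { intros v' [[e' [He' Hev']] _].
        rewrite (empty_unique _ _ He He'). exact Hev'. }
      apply Hw. auto.
    + intros x Hx. apply Hw in Hx as [_ Hx].
      destruct (succ_exists x) as [s Hs]. exists s. split; [exact Hs|].
      assert (H : forall v', inductive_set M v' -> s ∈ v').
      { intros v' Hv'. destruct (proj2 Hv' x (Hx v' Hv')) as [s' [Hs' Hsv']].
        rewrite (succ_unique _ _ _ Hs Hs'). exact Hsv'. }
      apply Hw. auto.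
  - intros w' Hw' x Hx. apply Hw in Hx. apply Hx, Hw'.
Qed.

Lemma omega_unique v w : is_omega M v -> is_omega M w -> v = w.
Proof.
  intros [Hv Hvmin] [Hw Hwmin]. apply (extensionality hM). intro t.
  split; [apply (Hvmin w Hw) | apply (Hwmin v Hv)].
Qed.

Section Omega.
Variable w : M.
Hypothesis Hw : is_omega M w.
Implicit Types i j k m n : M.

Lemma omega_empty e : is_empty M e -> e ∈ w.
Proof.
  destruct Hw as [[[e' [He' H]] _] _]. intro He.
  rewrite (empty_unique _ _ He He'). exact H.
Qed.

Lemma omega_succ n s : n ∈ w -> is_succ M n s -> s ∈ w.
Proof.
  destruct Hw as [[_ H] _]. intros Hn Hs. destruct (H n Hn) as [s' [Hs' Hsw]].
  rewrite (succ_unique _ _ _ Hs Hs'). exact Hsw.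
Qed.

(** Definability makes the members of ω satisfying [P] a set of the model; that set is inductive, so
    it contains ω by minimality. *)
Lemma omega_ind (P : M -> (nat -> M) -> Prop) (r : nat -> M) :
  definable1 M P ->
  (forall e, is_empty M e -> P e r) ->
  (forall n s, n ∈ w -> P n r -> is_succ M n s -> P s r) ->
  forall n, n ∈ w -> P n r.
Proof.
  intros HP H0 HS n Hn.
  destruct (separation_definable P r w HP) as [b Hb].
  assert (Hind : inductive_set M b).
  { split.
    - destruct empty_exists as [e He]. exists e. split; [exact He|].
      apply Hb. split; [apply omega_empty|apply H0]; exact He.
    - intros x Hx. apply Hb in Hx as [Hx HPx].
      destruct (succ_exists x) as [s Hs]. exists s. split; [exact Hs|].
      apply Hb. split; [exact (omega_succ _ _ Hx Hs) | exact (HS _ _ Hx HPx Hs)]. }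
  apply (proj2 Hw b Hind) in Hn. apply Hb in Hn. tauto.
Qed.

Lemma omega_mem_trans i m n : n ∈ w -> i ∈ m -> m ∈ n -> i ∈ n.
Proof.
  intros Hn. revert i m.
  apply (omega_ind (fun n _ => forall i m, i ∈ m -> m ∈ n -> i ∈ n)
    (fun _ => w)) with (n := n); [prove_definable| | |exact Hn].
  - intros e He i m _ Hm. destruct (He m Hm).
  - intros k s _ IH Hs i m Hi Hm. apply Hs. apply Hs in Hm as [Hm | ->]; eauto.
Qed.

Lemma omega_transitive m n : n ∈ w -> m ∈ n -> m ∈ w.
Proof.
  intros Hn. revert m.
  apply (omega_ind (fun n r => forall m, m ∈ n -> m ∈ r 0)
    (fun _ => w)) with (n := n); [prove_definable| | |exact Hn].
  - intros e He m Hm. destruct (He m Hm).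
  - intros k s Hk IH Hs m Hm. apply Hs in Hm as [Hm | ->]; auto.
Qed.

Lemma omega_succ_le m n s :
  n ∈ w -> m ∈ n -> is_succ M m s -> s ∈ n \/ s = n.
Proof.
  intros Hn. revert m s.
  apply (omega_ind
    (fun n _ => forall m s, m ∈ n -> is_succ M m s -> s ∈ n \/ s = n)
    (fun _ => w)) with (n := n); [prove_definable| | |exact Hn].
  - intros e He m s Hm. destruct (He m Hm).
  - intros k s' _ IH Hs' m s Hm Hs.
    apply Hs' in Hm as [Hm | ->].
    + left. apply Hs'. eauto.
    + right. exact (succ_unique _ _ _ Hs Hs').
Qed.

Lemma omega_empty_le e n : is_empty M e -> n ∈ w -> e ∈ n \/ e = n.
Proof.
  intros He Hn.
  apply (omega_ind (fun n r => r 0 ∈ n \/ r 0 = n)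
    (fun _ => e)) with (n := n); [prove_definable| | |exact Hn].
  - intros e' He'. right. exact (empty_unique _ _ He He').
  - intros k s _ IH Hs. left. apply Hs. exact IH.
Qed.

(** Induction on [n] with [m] as parameter: [omega_empty_le] gives the base, and [omega_succ_le]
    handles the step when the predecessor lies in [m]. *)
Lemma omega_trichotomy m n : m ∈ w -> n ∈ w -> m ∈ n \/ m = n \/ n ∈ m.
Proof.
  intros Hm Hn.
  apply (omega_ind (fun n r => r 0 ∈ n \/ r 0 = n \/ n ∈ r 0)
    (fun _ => m)) with (n := n); [prove_definable| | |exact Hn].
  - intros e He. destruct (omega_empty_le e m He Hm); auto.
  - intros k s _ IH Hs. destruct IH as [H | [H | H]].
    + left. apply Hs. auto.
    + left. apply Hs. auto.
    + destruct (omega_succ_le k m s Hm H Hs); auto.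
Qed.

(** Foundation supplies a minimal member directly, and trichotomy makes it unique. This canonical
    selection replaces choice in the countability arguments. *)
Lemma omega_subset_has_unique_minimum a :
  subset M a w -> (exists n, n ∈ a) ->
  exists! n, n ∈ a /\ forall m, m ∈ a -> ~ m ∈ n.
Proof.
  intros Ha Hne. destruct (foundation hM a Hne) as [n [Hn Hmin]].
  exists n. split.
  - split; [exact Hn|]. intros m Hm Hmn. exact (Hmin m (conj Hmn Hm)).
  - intros m [Hm Hmin'].
    destruct (omega_trichotomy n m (Ha _ Hn) (Ha _ Hm)) as [H | [H | H]].
    + destruct (Hmin' n Hn H).
    + exact H.
    + destruct (Hmin m (conj H Hm)).
Qed.

(** ** Countable and finite sets *)

(** The relation need not be functional from [B] to ω: it becomes so by taking
    least values. *)
Lemma countable_intro (R : M -> M -> (nat -> M) -> Prop) (r : nat -> M) B :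
  definable2 M R ->
  (forall y, y ∈ B -> exists n, n ∈ w /\ R y n r) ->
  (forall y y' n, y ∈ B -> y' ∈ B -> R y n r -> R y' n r -> y = y') ->
  countable M B.
Proof.
  intros HR Htot Hinj.
  (* With [R] replaced by the set [g], minimality of a value is expressed in the vocabulary that
     [prove_definable] handles. *)
  destruct (relation_exists R r B w HR) as [g [_ Hg]].
  destruct (function_exists
    (fun y n r => maps_to M (r 0) y n /\
       forall m, maps_to M (r 0) y m -> ~ m ∈ n)
    (fun _ => g) B w ltac:(prove_definable)) as [f [Hf Hmap]].
  - intros y Hy.
    destruct (separation_definable (fun n r => maps_to M (r 0) (r 1) n)
      (g .: fun _ => y) w ltac:(prove_definable)) as [a Ha].
    cbn [scons] in Ha.
    destruct (omega_subset_has_unique_minimum a) as [n [[Hn Hmin] Huniq]].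
    + intros n Hn. apply Ha in Hn. tauto.
    + destruct (Htot y Hy) as [n [Hn HRn]]. exists n.
      apply Ha. split; [exact Hn|]. apply Hg. auto.
    + apply Ha in Hn. exists n. split.
      * split; [tauto|]. split; [tauto|]. intros m Hm. apply Hmin, Ha.
        split; [|exact Hm]. apply Hg in Hm. tauto.
      * intros m (Hmw & Hm & Hm'). apply Huniq. split; [apply Ha; auto|].
        intros k Hk. apply Hm'. apply Ha in Hk. tauto.
  - exists w, f. split; [exact Hw|]. split; [exact Hf|].
    intros y y' n Hy Hy'. apply Hmap in Hy, Hy'.
    destruct Hy as (Hy & _ & Hyn & _), Hy' as (Hy' & _ & Hyn' & _).
    apply Hg in Hyn, Hyn'. apply (Hinj y y' n); tauto.
Qed.

Lemma dedekind_infinite_infinite x : dedekind_infinite M x -> infinite M x.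
Proof.
  intros (w' & h & Hw' & Hh & Hhinj) (w'' & n & g & Hw'' & Hn & [Hg Hginj] & _).
  rewrite (omega_unique _ _ Hw' Hw) in *.
  rewrite (omega_unique _ _ Hw'' Hw) in *.
  set (r := w .: h .: fun _ => g).
  (* A partial function from a natural number to ω is bounded; apply this to
     [g] followed by the inverse of [h]. *)
  assert (Hbound : exists b, b ∈ w /\ forall i m, i ∈ n -> m ∈ w ->
    (exists y, maps_to M h m y /\ maps_to M g y i) -> m ∈ b).
  { refine (omega_ind (fun n r => exists b, b ∈ r 0 /\
      forall i m, i ∈ n -> m ∈ r 0 ->
      (exists y, maps_to M (r 1) m y /\ maps_to M (r 2) y i) -> m ∈ b)
      r ltac:(prove_definable) _ _ n Hn); cbn [r scons].
    - intros e He. exists e. split; [exact (omega_empty e He)|].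
      intros i m Hi. destruct (He i Hi).
    - intros k s Hk [b [Hb Hbound]] Hs.
      destruct (classic (exists m, m ∈ w /\
        exists y, maps_to M h m y /\ maps_to M g y k))
        as [(m & Hm & y & Hmy & Hyk) | Hnone].
      + assert (Huniq : forall m', (exists y, maps_to M h m' y /\
          maps_to M g y k) -> m' = m).
        { intros m' (y' & Hmy' & Hyk').
          rewrite (Hginj _ _ _ Hyk' Hyk) in Hmy'.
          exact (Hhinj _ _ _ Hmy' Hmy). }
        (* The new bound is the larger of [b] and the successor [c] of the one additional value
           [m]. *)
        destruct (succ_exists m) as [c Hc].
        pose proof (omega_succ _ _ Hm Hc) as Hcw.
        assert (Hmc : m ∈ c) by (apply Hc; auto).
        destruct (omega_trichotomy b c Hb Hcw) as [H | H].
        * exists c. split; [exact Hcw|]. intros i m' Hi Hm' Hr.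
          apply Hs in Hi as [Hi | ->].
          -- apply omega_mem_trans with b; eauto.
          -- rewrite (Huniq m' Hr). exact Hmc.
        * exists b. split; [exact Hb|]. intros i m' Hi Hm' Hr.
          apply Hs in Hi as [Hi | ->]; [eauto|].
          rewrite (Huniq m' Hr). destruct H as [-> | H]; [exact Hmc|].
          apply omega_mem_trans with c; auto.
      + exists b. split; [exact Hb|]. intros i m' Hi Hm' Hr.
        apply Hs in Hi as [Hi | ->]; [eauto|]. destruct Hnone. eauto. }
  (* The bound [b] is itself a natural number, hence one of the bounded values, so [b ∈ b]. *)
  destruct Hbound as [b [Hb Hbound]].
  destruct (function_total _ _ _ _ Hh Hb) as [y [Hy Hby]].
  destruct (function_total _ _ _ _ Hg Hy) as [i [Hi Hyi]].
  apply (mem_irrefl b). eauto.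
Qed.

End Omega.

(** * Closure properties and basic examples of countable sets *)

Lemma countable_subset a b : countable M b -> subset M a b -> countable M a.
Proof.
  intros (w & f & Hw & Hf & Hinj) Hab.
  apply (countable_intro w Hw (fun y n r => maps_to M (r 0) y n)
    (fun _ => f) a ltac:(prove_definable)).
  - intros y Hy. exact (function_total _ _ _ _ Hf (Hab y Hy)).
  - intros y y' n _ _. apply Hinj.
Qed.

(** Each [y] is related to the codes of all its preimages, and [countable_intro] takes the least
    one, so no preimages have to be chosen. *)
Lemma countable_image (R : M -> M -> (nat -> M) -> Prop) (r : nat -> M) A B :
  definable2 M R -> countable M A ->
  (forall y, y ∈ B -> exists x, x ∈ A /\ R x y r) ->
  (forall x y y', y ∈ B -> y' ∈ B -> R x y r -> R x y' r -> y = y') ->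
  countable M B.
Proof.
  intros HR (w & f & Hw & Hf & Hinj) Hsurj Hfun.
  destruct (relation_exists R r A B HR) as [g [_ Hg]].
  apply (countable_intro w Hw
    (fun y n r => exists x, maps_to M (r 0) x n /\ maps_to M (r 1) x y)
    (f .: fun _ => g) B ltac:(prove_definable)); cbn [scons].
  - intros y Hy. destruct (Hsurj y Hy) as [x [Hx Hxy]].
    destruct (function_total _ _ _ _ Hf Hx) as [n [Hn Hxn]].
    exists n. split; [exact Hn|]. exists x. split; [exact Hxn|].
    apply Hg. auto.
  - intros y y' n Hy Hy' (x & Hxn & Hxy) (x' & Hxn' & Hxy').
    rewrite (Hinj _ _ _ Hxn' Hxn) in Hxy'. apply Hg in Hxy, Hxy'.
    apply (Hfun x y y'); tauto.
Qed.

Lemma countable_omega w : is_omega M w -> countable M w.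
Proof.
  intro Hw. apply (countable_intro w Hw (fun y n _ => y = n) (fun _ => w) w
    ltac:(prove_definable)).
  - eauto.
  - intros; congruence.
Qed.

Lemma countable_range w f B a :
  is_omega M w -> is_function M f w B ->
  (forall y, y ∈ a -> exists n, maps_to M f n y) -> countable M a.
Proof.
  intros Hw Hf Ha.
  apply (countable_image (fun n y r => maps_to M (r 0) n y) (fun _ => f) w a
    ltac:(prove_definable) (countable_omega w Hw)).
  - intros y Hy. destruct (Ha y Hy) as [n Hn]. exists n. split; [|exact Hn].
    exact (function_domain _ _ _ _ _ Hf Hn).
  - intros n y y' _ _. apply (function_unique _ _ _ _ _ _ Hf).
Qed.

Lemma countable_finite x : finite M x -> countable M x.
Proof.
  intros (w & n & f & Hw & Hn & [Hf Hinj] & _).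
  apply (countable_intro w Hw (fun y n r => maps_to M (r 0) y n)
    (fun _ => f) x ltac:(prove_definable)).
  - intros y Hy. destruct (function_total _ _ _ _ Hf Hy) as [m [Hm Hym]].
    exists m. split; [exact (omega_transitive w Hw _ _ Hn Hm) | exact Hym].
  - intros y y' m _ _. apply Hinj.
Qed.

Lemma finite_empty e : is_empty M e -> finite M e.
Proof.
  intro He. destruct omega_exists as [w Hw].
  exists w, e, e. split; [exact Hw|]. split; [exact (omega_empty w Hw e He)|].
  repeat split; try (intros t Ht; destruct (He t Ht)).
  intros x x' y (p & _ & Hp). destruct (He p Hp).
Qed.

Lemma countable_empty e : is_empty M e -> countable M e.
Proof. intro He. apply countable_finite, finite_empty, He. Qed.

Lemma finite_singleton a s : is_upair M a a s -> finite M s.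
Proof.
  intro Hs. destruct omega_exists as [w Hw].
  destruct empty_exists as [e He]. destruct (succ_exists e) as [n Hn].
  assert (Hn1 : forall t, t ∈ n <-> t = e).
  { intro t. rewrite (Hn t). specialize (He t). tauto. }
  assert (Hs1 : forall t, t ∈ s <-> t = a).
  { intro t. rewrite (Hs t). tauto. }
  destruct (function_exists (fun _ y r => y = r 0) (fun _ => e) s n
    ltac:(prove_definable)) as [f [Hf Hmap]].
  { intros x _. exists e. split; [rewrite (Hn1 e); auto|].
    intros y [_ Hy]. auto. }
  exists w, n, f. split; [exact Hw|].
  split; [exact (omega_succ w Hw e n (omega_empty w Hw e He) Hn)|].
  split; [split; [exact Hf|]|].
  - intros x x' y Hx Hx'. apply Hmap in Hx, Hx'.
    destruct Hx as [Hx _], Hx' as [Hx' _]. apply Hs1 in Hx, Hx'. congruence.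
  - intros y Hy. exists a. apply Hmap. rewrite (Hs1 a), <- (Hn1 y). auto.
Qed.

Lemma countable_upair a b p : is_upair M a b p -> countable M p.
Proof.
  intro Hp. destruct omega_exists as [w Hw].
  destruct empty_exists as [e He]. destruct (succ_exists e) as [n Hn].
  pose proof (omega_empty w Hw e He) as Hew.
  apply (countable_intro w Hw
    (* The values are 0 for [a] and 1 for [b]. If [a = b], that element gets both, which
       [countable_intro] permits. *)
    (fun y m r => (y = r 0 /\ m = r 2) \/ (y = r 1 /\ m = r 3))
    (a .: b .: e .: fun _ => n) p ltac:(prove_definable)); cbn [scons].
  - intros y Hy. apply Hp in Hy as [-> | ->]; [exists e | exists n].
    + auto.
    + split; [exact (omega_succ w Hw _ _ Hew Hn) | auto].
  - assert (e <> n).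
    { intros ->. apply (He n), Hn. auto. }
    intros y y' m _ _ [[? ?]|[? ?]] [[? ?]|[? ?]]; congruence.
Qed.

(** ** The principles *)

Lemma CUC_sigma_ideal X : CUC M -> is_sigma_ideal M (countable_subsets M X).
Proof.
  intro hC. split; [split; [|split]|].
  - intros e He. split; [|exact (countable_empty e He)].
    intros t Ht. destruct (He t Ht).
  - intros a b [HbX Hb] Hab. split; [intros t Ht; auto|].
    exact (countable_subset a b Hb Hab).
  - intros a b u [HaX Ha] [HbX Hb] Hu. split.
    { intros t Ht. apply Hu in Ht as [Ht | Ht]; auto. }
    destruct (pairing hM a b) as [p Hp].
    apply (hC p u (countable_upair a b p Hp)).
    + intros x Hx. apply Hp in Hx as [-> | ->]; assumption.
    + intro t. rewrite (Hu t). split.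
      * intros [H | H]; [exists a | exists b]; rewrite (Hp _); auto.
      * intros [x [Hx Ht]]. apply Hp in Hx as [-> | ->]; auto.
  - intros w f B u Hw Hf HB Hu.
    assert (HBf : forall n y, maps_to M f n y -> y ∈ B).
    { intros n y Hy. pose proof (function_domain _ _ _ _ _ Hf Hy) as Hn.
      destruct (function_total _ _ _ _ Hf Hn) as [y' [Hy' Hny']].
      rewrite (function_unique _ _ _ _ _ _ Hf Hy Hny'). exact Hy'. }
    split.
    { intros t Ht. apply Hu in Ht as (n & y & Hy & Ht).
      apply (HB y (HBf n y Hy)), Ht. }
    (* CUC is applied to the set [A] of actual terms, because the codomain [B] may be
       uncountable. *)
    destruct (separation_definable (fun y r => exists n, maps_to M (r 0) n y)
      (fun _ => f) B ltac:(prove_definable)) as [A HA].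
    apply (hC A u).
    + apply (countable_range w f B A Hw Hf). intros y Hy.
      apply HA in Hy. tauto.
    + intros x Hx. apply HB, HA, Hx.
    + intro t. rewrite (Hu t). split.
      * intros (n & y & Hy & Ht). exists y. split; [|exact Ht].
        apply HA. split; [exact (HBf n y Hy) | exists n; exact Hy].
      * intros (y & Hy & Ht). apply HA in Hy as [_ [n Hn]]. eauto.
Qed.

(** The ideal is taken on the union [u] itself, where every member of [A] is a countable subset. An
    injection of [A] into ω reindexes the family as a sequence with the same union. *)
Lemma sigma_ideal_CUC :
  (forall X, infinite M X -> is_sigma_ideal M (countable_subsets M X)) -> CUC M.
Proof.
  intros H A u (w & g & Hw & Hg & Hginj) HA Hu.
  (* The hypothesis covers only infinite sets; a finite union is countable outright. *)
  destruct (classic (finite M u)) as [Hfin | Hinf];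
    [exact (countable_finite u Hfin)|].
  destruct (H u Hinf) as [_ Hsigma].
  destruct (power_set hM u) as [P HP].
  destruct (separation_definable (fun y _ => countable M y) (fun _ => u) P
    ltac:(prove_definable)) as [B HB].
  (* The term of index [g x] is [x]; indices outside the range of [g] get [∅]. *)
  set (r := A .: fun _ => g).
  destruct (function_exists
    (fun n y r => forall t,
       t ∈ y <-> exists x, x ∈ r 0 /\ maps_to M (r 1) x n /\ t ∈ x)
    r w B ltac:(prove_definable)) as [f [Hf Hmap]]; cbn [r scons] in *.
  - intros n Hn.
    cut (exists y, y ∈ B /\ forall t,
      t ∈ y <-> exists x, x ∈ A /\ maps_to M g x n /\ t ∈ x).
    { intros [y [Hy Hyt]]. exists y. split; [auto|].
      intros y' [_ Hy't]. apply (extensionality hM). intro t.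
      rewrite (Hyt t), (Hy't t). reflexivity. }
    destruct (classic (exists x, x ∈ A /\ maps_to M g x n))
      as [(x & Hx & Hxn) | Hnone].
    + exists x. split.
      * apply HB. split; [|auto]. apply HP. intros t Ht. apply Hu. eauto.
      * intro t. split; [eauto|]. intros (x' & _ & Hx'n & Ht).
        rewrite (Hginj _ _ _ Hxn Hx'n). exact Ht.
    + destruct empty_exists as [e He]. exists e. split.
      * apply HB. split; [|exact (countable_empty e He)].
        apply HP. intros t Ht. destruct (He t Ht).
      * intro t. split.
        -- intro Ht. destruct (He t Ht).
        -- intros (x & Hx & Hxn & _). destruct Hnone. eauto.
  - apply (Hsigma w f B u Hw Hf).
    + intros y Hy. apply HB in Hy as [HyP Hy].
      split; [apply HP, HyP | exact Hy].
    + intro t. rewrite (Hu t). split.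
      * intros (x & Hx & Ht).
        destruct (function_total _ _ _ _ Hg Hx) as [n [Hn Hxn]].
        destruct (function_total _ _ _ _ Hf Hn) as [y [_ Hny]].
        exists n, y. split; [exact Hny|]. apply Hmap in Hny. apply Hny. eauto.
      * intros (n & y & Hny & Ht). apply Hmap in Hny as (_ & _ & Hy).
        apply Hy in Ht as (x & Hx & _ & Ht). eauto.
Qed.

(** * P-space principles and countable unions *)

Lemma subset_refl x : subset M x x.
Proof. intros t Ht. exact Ht. Qed.

Lemma PS0_PS1 : PS0 M -> PS1 M.
Proof.
  intros H X HX. exists X. split; [apply subset_refl|]. auto.
Qed.

(** Members of [A] may reach outside [Y], so a family whose union contains [Y] can be used
    unchanged. *)
Lemma P_space_countable_cover A Y :
  S_countable_is_P_space M Y -> countable M A ->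
  (forall a, a ∈ A -> countable M a) ->
  (forall t, t ∈ Y -> exists a, a ∈ A /\ t ∈ a) -> countable M Y.
Proof.
  intros HY HA HAc Hcover.
  destruct (power_set hM Y) as [P HP]. destruct (power_set hM P) as [PP HPP].
  set (r := Y .: fun _ => A).
  destruct (separation_definable
    (fun U r => exists a, a ∈ r 1 /\ forall x,
      x ∈ U <-> finite_subsets M (r 0) x /\ disjoint M x a)
    r PP ltac:(prove_definable)) as [F HF].
  (* The set [g] is the intersection of the family [F] inside the space, hence a $G_\delta$-set once
     [F] is shown to be countable and its members open. *)
  destruct (separation_definable
    (fun x r => finite_subsets M (r 0) x /\ forall U, U ∈ r 1 -> x ∈ U)
    (Y .: fun _ => F) P ltac:(prove_definable)) as [g Hg].
  cbn [r scons] in HF, Hg.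
  assert (HFa : forall a, a ∈ A -> exists U, U ∈ F /\ forall x,
    x ∈ U <-> finite_subsets M Y x /\ disjoint M x a).
  { intros a Ha.
    destruct (separation_definable
      (fun x r => finite_subsets M (r 0) x /\ disjoint M x (r 1))
      (Y .: fun _ => a) P ltac:(prove_definable)) as [U HU].
    cbn [scons] in HU.
    assert (HU' : forall x, x ∈ U <-> finite_subsets M Y x /\ disjoint M x a).
    { intro x. rewrite (HU x). split; [tauto|]. intros [Hx Hxa].
      split; [apply HP, Hx | auto]. }
    exists U. split; [|exact HU']. apply HF. split; [|eauto].
    apply HPP. intros x Hx. apply HU in Hx. tauto. }
  assert (HFc : countable M F).
  { apply (countable_image (fun a U r => forall x,
      x ∈ U <-> finite_subsets M (r 0) x /\ disjoint M x a) r A F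
      ltac:(prove_definable) HA); cbn [r scons].
    - intros U HU. apply HF in HU. tauto.
    - intros a U U' _ _ HU HU'. apply (extensionality hM). intro x.
      rewrite (HU x), (HU' x). reflexivity. }
  assert (Hgo : S_open M Y (countable_subsets M Y) g).
  { apply HY. exists F. split; [exact HFc|]. split.
    - intros U HU. apply HF in HU as [_ (a & Ha & HU)].
      split; [intros x Hx; apply HU, Hx|].
      intros x Hx. apply HU in Hx as [_ Hxa].
      (* The witness is the intersection of [a] with [Y], as the ideal contains only subsets of [Y].
         Finite subsets of [Y] miss it exactly when they miss [a]. *)
      destruct (separation_definable (fun t r => t ∈ r 0) (fun _ => a) Y
        ltac:(prove_definable)) as [z Hz].
      exists z. split; [split|split].
      + intros t Ht. apply Hz in Ht. tauto.
      + apply (countable_subset z a (HAc a Ha)). intros t Ht.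
        apply Hz in Ht. tauto.
      + intros t [Htx Htz]. apply Hz in Htz. apply (Hxa t). tauto.
      + intros y Hy _ Hyz. apply HU. split; [exact Hy|].
        intros t [Hty Hta]. apply (Hyz t). split; [exact Hty|].
        apply Hz. split; [apply Hy, Hty | exact Hta].
    - intro x. rewrite (Hg x). split; [tauto|]. intros [Hx HU].
      split; [apply HP, Hx | auto]. }
  destruct empty_exists as [e He].
  assert (Heg : e ∈ g).
  { assert (HeY : finite_subsets M Y e).
    { split; [intros t Ht; destruct (He t Ht) | exact (finite_empty e He)]. }
    apply Hg. split; [apply HP, HeY|]. split; [exact HeY|].
    intros U HU. apply HF in HU as [_ (a & _ & HU)]. apply HU.
    split; [exact HeY|]. intros t [Ht _]. exact (He t Ht). }
  (* Openness at ∅ gives a countable [z] such that every finite subset of [Y] missing [z] lies in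
     [g]. A point [t] of [Y] outside [z] would put its singleton in [g], although some [a] in [A]
     contains [t]. *)
  destruct (proj2 Hgo e Heg) as (z & [_ Hz] & _ & Hzg).
  apply (countable_subset Y z Hz). intros t Ht. apply NNPP. intro Htz.
  destruct (pairing hM t t) as [s Hs].
  assert (Hsg : s ∈ g).
  { apply Hzg.
    - split; [|exact (finite_singleton t s Hs)].
      intros t' Ht'. apply Hs in Ht' as [-> | ->]; exact Ht.
    - intros t' Ht'. destruct (He t' Ht').
    - intros t' [Ht' Ht'z]. apply Hs in Ht' as [-> | ->]; auto. }
  destruct (Hcover t Ht) as (a & Ha & Hta). destruct (HFa a Ha) as (U & HUF & HU).
  apply Hg in Hsg as (_ & _ & Hsg). specialize (Hsg U HUF).
  apply (proj2 (proj1 (HU s) Hsg) t). split; [apply Hs; auto | exact Hta].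
Qed.

Lemma PS1_CUC : PS1 M -> CUC M.
Proof.
  intros H A u HA HAc Hu. apply NNPP. intro Hunc.
  destruct (H u Hunc) as (Y & HYu & HY & HP).
  apply HY, (P_space_countable_cover A Y HP HA HAc).
  intros t Ht. apply Hu, HYu, Ht.
Qed.

(** The space is discrete: for a finite [x], the complement of [x] in [Y] is an admissible [z], and
    the only finite set that contains [x] and misses this [z] is [x]. *)
Lemma countable_P_space Y : countable M Y -> S_countable_is_P_space M Y.
Proof.
  intros HY g (F & _ & _ & Hg).
  split; [intros x Hx; apply Hg, Hx|].
  intros x Hx.
  destruct (separation_definable (fun t r => ~ t ∈ r 0) (fun _ => x) Y
    ltac:(prove_definable)) as [z Hz].
  assert (HzY : subset M z Y) by (intros t Ht; apply Hz in Ht; tauto).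
  exists z. split; [exact (conj HzY (countable_subset z Y HY HzY))|]. split.
  - intros t [Htx Htz]. apply Hz in Htz. tauto.
  - intros y [HyY _] Hxy Hyz. replace y with x; [exact Hx|].
    apply (extensionality hM). intro t. split; [apply Hxy|].
    intro Ht. apply NNPP. intro Htx. apply (Hyz t). split; [exact Ht|].
    apply Hz. split; [apply HyY, Ht | exact Htx].
Qed.

Lemma IDI_PS2 : IDI M -> PS2 M.
Proof.
  intros H X HX. destruct (H X HX) as (w & h & Hw & Hh & Hinj).
  destruct (separation_definable (fun y r => exists n, maps_to M (r 0) n y)
    (fun _ => h) X ltac:(prove_definable)) as [Y HY].
  exists Y. split; [|split].
  - intros y Hy. apply HY in Hy. tauto.
  (* The same [h] is reused with its codomain shrunk to its range [Y], so only the typing of its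
     pairs has to be checked again. *)
  - apply (dedekind_infinite_infinite w Hw). exists w, h.
    split; [exact Hw|]. split; [|exact Hinj]. split; [|apply Hh].
    intros p Hp. destruct (proj1 Hh p Hp) as (x & y & Hx & Hy & Hpair).
    exists x, y. split; [exact Hx|]. split; [|exact Hpair].
    apply HY. split; [exact Hy|]. exists x, p. auto.
  - apply countable_P_space, (countable_range w h X Y Hw Hh).
    intros y Hy. apply HY in Hy. tauto.
Qed.

End ZF.

Theorem theorem7p4 (M : set_structure) (hM : models_ZF M) :
  (CUC M <->
     forall X : M, infinite M X -> is_sigma_ideal M (countable_subsets M X)) /\
  ((PS0 M -> PS1 M) /\ (PS1 M -> CUC M)) /\
  (IDI M -> PS2 M).
Proof.
  split; [split|split; [split|]].
  - intros H X _. exact (CUC_sigma_ideal M hM X H).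
  - exact (sigma_ideal_CUC M hM).
  - exact (PS0_PS1 M).
  - exact (PS1_CUC M hM).
  - exact (IDI_PS2 M hM).
Qed.
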